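(* There exists a minimal, weakly mixing homeomorphism $T\colon X\to X$ of a Cantor set $X$ which is conjugate to a homeomorphism $f\colon K\to K$ of a Cantor set $K\subseteq\mathbb{R}$ satisfying $f'(x)=0$ for every $x\in K$.
   Context: A Cantor set is a compact metric space that is totally disconnected and has no isolated points. $(X,T)$ is minimal if $X$ has no nonempty proper closed subset $A$ with $T(A)=A$; transitive if for all nonempty open $U,V\subseteq X$ there is $n\in\mathbb{N}$ with $T^n(U)\cap V\neq\emptyset$; weakly mixing if $(X\times X,T\times T)$ is transitive. Conjugacy means there is a homeomorphism $h\colon X\to K$ with $h\circ T=f\circ h$. For $K\subseteq\mathbb{R}$ perfect, $f'(x)=\lim_{y\to x,\,y\in K\setminus\{x\}}\frac{f(y)-f(x)}{y-x}$. *)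

(* Defs.v *)
From HB Require Import structures.
From mathcomp Require Import all_boot all_order all_algebra.
From mathcomp Require Import all_classical all_reals all_analysis.
From mathcomp Require Import Rstruct Rstruct_topology.
Set Implicit Arguments. Unset Strict Implicit. Unset Printing Implicit Defensive.
Import Order.TTheory GRing.Theory Num.Theory.
Local Open Scope classical_set_scope.
Local Open Scope ring_scope.

Definition cantor_set {T : topologicalType} (A : set T) : Prop :=
  [/\ A !=set0, compact A, totally_disconnected A &
      forall x, A x -> ~ isolated A x].

Definition homeo_onto {U V : topologicalType} (A : set U) (B : set V)
    (f : U -> V) : Prop :=
  [/\ f @` A `<=` B, {within A, continuous f} &
      exists g : V -> U, [/\ g @` B `<=` A, {within B, continuous g},
        (forall x, A x -> g (f x) = x) & (forall y, B y -> f (g y) = y)]].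

Definition minimal_sys {X : topologicalType} (T : X -> X) : Prop :=
  forall A : set X, A !=set0 -> closed A -> T @` A = A -> A = [set: X].

Definition transitive_sys {X : topologicalType} (T : X -> X) : Prop :=
  forall U V : set X, open U -> open V -> U !=set0 -> V !=set0 ->
    exists n : nat, (0 < n)%N /\ ((iter n T) @` U `&` V) !=set0.

Definition weakly_mixing {X : topologicalType} (T : X -> X) : Prop :=
  transitive_sys (fun p : X * X => (T p.1, T p.2)).

Definition zero_deriv_on (K : set Rdefinitions.R) (f : Rdefinitions.R -> Rdefinitions.R) : Prop :=
  forall x, K x ->
    (fun y => (f y - f x) / (y - x)) @ within K x^' --> (0 : Rdefinitions.R).

(* Main.v *)
(* X is the space of infinite threads of an inverse limit of finite graphs G_n,
   each made of two loops A_n and B_n of lengths a_n and a_n + 1 sharing one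
   vertex u_n, the hub.  The bonding map wraps A_(n+1) and B_(n+1) along cyclic
   shifts of the closed walks A^(n+3) B^(n+2) A and A^(n+3) B^(n+2) B of G_n;
   T moves every coordinate one step along its graph.

   Every loop of G_(n+1) covers G_n, so T is minimal.  The powers A^d and B^d
   occur in both walks for d < n + 2, so that d a_n and d a_n + d are both
   return times to the hub of G_n: return times realise every difference, which
   is weak mixing.

   The shift is chosen so that u_(n+1) lies over an interior vertex w_n of A_n
   (the gate), and w_(n+1) lies over w_n too; hence a thread meets at most one
   hub.  Embed X in R so that two threads parting after level n at position j of
   a loop are at distance comparable to s_n(j), with s_n(j + 1) / s_n(j) tending
   to 0 with n.  Applying T raises j by one except when x or T x is at the hub of
   level n, which happens for finitely many n only: the derivative vanishes. *)
Require Import Defs.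
From HB Require Import structures.
From mathcomp Require Import all_boot all_order all_algebra.
From mathcomp Require Import all_classical all_reals all_analysis.
From mathcomp Require Import Rstruct Rstruct_topology.
From mathcomp Require Import zify ring lra.
Set Implicit Arguments. Unset Strict Implicit. Unset Printing Implicit Defensive.
Import Order.TTheory GRing.Theory Num.Theory.
Local Open Scope classical_set_scope.
Local Notation R := Rdefinitions.R.

(** * The graphs *)

Fixpoint short_len n :=
  if n is m.+1 then
    m.+3 * short_len m + m.+2 * (short_len m).+1 + short_len m
  else 2.

Definition len n (c : bool) := short_len n + c.

Definition core_len n := n.+3 * short_len n + n.+2 * (short_len n).+1.

Lemma lenS n c : len n.+1 c = core_len n + len n c.
Proof. by rewrite /len /= addnA. Qed.

(** Both the shift of the walks and the position of the gate on A_n. One whole turn of A_m puts the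
    gate of level [m.+1] over that of level [m]; at level 0, 1 is the only interior position of
    A_0. *)
Definition base_pos n := if n is m.+1 then short_len m else 1.

Lemma short_len_gt1 n : 1 < short_len n.
Proof. by elim: n => //= n IH; lia. Qed.

Lemma base_pos_gt0 n : 0 < base_pos n.
Proof. by case: n => //= n; have := short_len_gt1 n; lia. Qed.

Lemma base_pos_lt n : base_pos n < short_len n.
Proof. by case: n => //= n; have := short_len_gt1 n; lia. Qed.

Lemma len_false n : len n false = short_len n. Proof. exact: addn0. Qed.
Lemma len_true n : len n true = (short_len n).+1. Proof. exact: addn1. Qed.

Lemma len_gt0 n c : 0 < len n c.
Proof. by have := short_len_gt1 n; rewrite /len; lia. Qed.

(* A vertex is a loop ([false] for A, [true] for B) and a position on it; the
   pair [(true, 0)] is not used, the hub being [(false, 0)]. *)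
Definition vertex := (bool * nat)%type.
Definition hub : vertex := (false, 0).

Definition pos n c j : vertex :=
  if j %% len n c == 0 then hub else (c, j %% len n c).

Definition valid n (v : vertex) := exists c j, v = pos n c j.

Definition edge n (v v' : vertex) :=
  exists c j, v = pos n c j /\ v' = pos n c j.+1.

Lemma pos0 n c : pos n c 0 = hub.
Proof. by rewrite /pos mod0n eqxx. Qed.

Lemma posMD n c k j : pos n c (k * len n c + j) = pos n c j.
Proof. by rewrite /pos modnMDl. Qed.

Lemma pos_mul n c k : pos n c (k * len n c) = hub.
Proof. by rewrite -[k * _]addn0 posMD pos0. Qed.

Lemma pos_len n c : pos n c (len n c) = hub.
Proof. by rewrite -[X in pos _ _ X]mul1n pos_mul. Qed.

Lemma pos_small n c j : 0 < j < len n c -> pos n c j = (c, j).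
Proof. by case/andP => j0 jl; rewrite /pos modn_small // -[j == 0]negbK -lt0n j0. Qed.

Lemma pos_mod n c j : pos n c (j %% len n c) = pos n c j.
Proof. by rewrite /pos modn_mod. Qed.

Lemma pos_modS n c j : pos n c (j %% len n c).+1 = pos n c j.+1.
Proof. by rewrite /pos -addn1 modnDml addn1. Qed.

Lemma valid_hub n : valid n hub.
Proof. by exists false, 0; rewrite pos0. Qed.

Lemma valid_pos n c j : valid n (pos n c j).
Proof. by exists c, j. Qed.

Lemma validP n v : valid n v -> v <> hub -> 0 < v.2 < len n v.1.
Proof.
by case=> c [j ->]; rewrite /pos; case: eqVneq => //= j0 _;
  rewrite lt0n j0 ltn_mod len_gt0.
Qed.

Lemma valid_eq n v : valid n v -> pos n v.1 v.2 = v.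
Proof.
move=> vv; case: (v =P hub) => [->|vh]; first exact: pos0.
by rewrite pos_small ?validP //; case: (v).
Qed.

Lemma valid_lt n v : valid n v -> v.2 < len n v.1.
Proof.
move=> vv; case: (v =P hub) => [->|vh]; first exact: len_gt0.
by have /andP[] := validP vv vh.
Qed.

Lemma edge_pos n c j : edge n (pos n c j) (pos n c j.+1).
Proof. by exists c, j. Qed.

Lemma edge_small n v v' : edge n v v' ->
  exists c j, [/\ j < len n c, v = pos n c j & v' = pos n c j.+1].
Proof.
case=> c [j [-> ->]]; exists c, (j %% len n c).
by rewrite ltn_mod len_gt0 pos_mod pos_modS.
Qed.

Lemma edge_interior n v v' : edge n v v' -> v <> hub ->
  v' = pos n v.1 v.2.+1.
Proof.
case/edge_small => c [j [jl -> ->]] vh.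
have j0 : 0 < j by case: j vh {jl} => //; rewrite pos0.
by rewrite (pos_small (j := j)) ?j0.
Qed.

Lemma edge_hub n v : edge n hub v -> exists c, v = pos n c 1.
Proof.
case/edge_small => c [j [jl E ->]]; exists c.
by case: j jl E => // j jl; rewrite pos_small.
Qed.

Lemma edge_into_hub n v : edge n v hub -> exists c, v = pos n c (len n c).-1.
Proof.
case/edge_small => c [j [jl -> E]]; exists c; congr pos.
have [jS|jS] := ltnP j.+1 (len n c); last by lia.
by move: E; rewrite pos_small.
Qed.

Lemma edge_into_interior n v v' : edge n v v' -> v' <> hub ->
  v = pos n v'.1 v'.2.-1.
Proof.
case/edge_small => c [j [jl -> ->]] vh.
have [jS|jS] := ltnP j.+1 (len n c); first by rewrite (pos_small (j := j.+1)).
by case: vh; rewrite (_ : j.+1 = len n c) ?pos_len //; lia.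
Qed.

(* Position [t] in A^(n+3) B^(n+2) followed by loop [c], then A; the trailing A
   lets the cyclic shift by [base_pos n] be read without wrapping around. *)
Definition walk n c t : vertex :=
  let a := short_len n in
  if t < n.+3 * a then pos n false t
  else if t < core_len n then pos n true (t - n.+3 * a)
  else if t < core_len n + len n c then pos n c (t - core_len n)
  else pos n false (t - (core_len n + len n c)).

(** The end point is included because each piece of the walk ends at the hub, where the next one
    starts; [walk_edge] can thus treat every step as lying inside one piece. *)
Lemma walk_short n c t : t <= n.+3 * short_len n ->
  walk n c t = pos n false t.
Proof.
rewrite leq_eqVlt /walk => /orP[/eqP ->|->//].
rewrite ltnn /core_len ifT ?subnn; last by lia.
have := pos_mul n false n.+3; rewrite /len addn0 => ->; exact: pos0.
Qed.

Lemma walk_long n c t : t <= n.+2 * (short_len n).+1 ->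
  walk n c (n.+3 * short_len n + t) = pos n true t.
Proof.
rewrite leq_eqVlt /walk => /orP[/eqP ->|tl].
  rewrite -/(core_len n) ltnn ifF; last by rewrite /core_len; lia.
  rewrite ifT ?subnn; last by have := len_gt0 n c; lia.
  have := pos_mul n true n.+2; rewrite /len addn1 => ->; exact: pos0.
by rewrite ifF ?ifT ?addKn // /core_len; lia.
Qed.

Lemma walk_last n c t : t <= len n c ->
  walk n c (core_len n + t) = pos n c t.
Proof.
have cE : n.+3 * short_len n <= core_len n by rewrite leq_addr.
rewrite leq_eqVlt /walk => /orP[/eqP ->|tl].
  rewrite !ifF ?subnn ?pos0 ?pos_len //; lia.
by rewrite ifF 1?ifF 1?ifT ?addKn //; lia.
Qed.

Lemma walk_wrap n c t :
  walk n c (core_len n + (len n c + t)) = pos n false t.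
Proof.
have cE : n.+3 * short_len n <= core_len n by rewrite leq_addr.
by rewrite /walk addnA !ifF ?addKn //; lia.
Qed.

Lemma walk_edge n c t : edge n (walk n c t) (walk n c t.+1).
Proof.
have [t1|t1] := ltnP t (n.+3 * short_len n).
  by rewrite !walk_short //; [exact: edge_pos | lia].
rewrite -(subnKC t1) -addnS; move: (t - _) => {t1}t.
have [t1|t1] := ltnP t (n.+2 * (short_len n).+1).
  by rewrite !walk_long //; [exact: edge_pos | lia].
rewrite -(subnKC t1) -addnS !addnA -/(core_len n); move: (t - _) => {t1}t.
have [t1|t1] := ltnP t (len n c).
  by rewrite !walk_last //; [exact: edge_pos | lia].
by rewrite -(subnKC t1) -!addnS !walk_wrap; exact: edge_pos.
Qed.

(** * The bonding maps *)

Definition phi n (v : vertex) := walk n v.1 (base_pos n + v.2).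

Definition gate n : vertex := (false, base_pos n).

Lemma gateE n : gate n = pos n false (base_pos n).
Proof. by rewrite pos_small // base_pos_gt0 /len addn0 base_pos_lt. Qed.

Lemma gate_neq_hub n : gate n <> hub.
Proof. by case=> E; have := base_pos_gt0 n; rewrite E. Qed.

Lemma phi_hub n : phi n hub = gate n.
Proof.
rewrite /phi addn0 walk_short ?gateE //.
by have := base_pos_lt n; lia.
Qed.

Lemma phi_gate n : phi n (gate n.+1) = gate n.
Proof.
rewrite /phi /= walk_short; last by have := base_pos_lt n; lia.
have := posMD n false 1 (base_pos n); rewrite mul1n /len addn0 addnC => ->.
by rewrite -gateE.
Qed.

(** At [j = len n.+1 c] the trailing A has brought the walk back to the gate, so [phi] respects the
    closing of the loop. *)
Lemma phi_pos n c j : j <= len n.+1 c ->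
  phi n (pos n.+1 c j) = walk n c (base_pos n + j).
Proof.
case: j => [|j].
  rewrite pos0 phi_hub addn0 walk_short ?gateE //.
  by have := base_pos_lt n; lia.
rewrite leq_eqVlt => /orP[/eqP->|jl]; last by rewrite pos_small.
by rewrite pos_len phi_hub lenS addnC -addnA walk_wrap gateE.
Qed.

Lemma phi_edge n v v' : edge n.+1 v v' -> edge n (phi n v) (phi n v').
Proof.
case/edge_small => c [j [jl -> ->]]; rewrite !phi_pos //; last by lia.
rewrite addnS; exact: walk_edge.
Qed.

Lemma phi_valid n v : valid n.+1 v -> valid n (phi n v).
Proof.
case=> c [j E].
have [c' [j' [-> _]]] := phi_edge (ex_intro _ c (ex_intro _ j (conj E erefl))).
exact: valid_pos.
Qed.

(** Both loops of level [n.+1] leave the hub along the same edge of A_n, the one out of the gate.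
    The choice of loop is invisible one level down, which makes [step] well defined. *)
Lemma phi_succ n v v1 v2 : edge n.+1 v v1 -> edge n.+1 v v2 ->
  phi n v1 = phi n v2.
Proof.
case: (v =P hub) => [->|vh] e1 e2; last first.
  by rewrite (edge_interior e1 vh) (edge_interior e2 vh).
have E v' : edge n.+1 hub v' -> phi n v' = pos n false (base_pos n).+1.
  case/edge_hub => c ->; rewrite phi_pos ?len_gt0 // addn1 walk_short //.
  by have := base_pos_lt n; lia.
by rewrite (E _ e1) (E _ e2).
Qed.

(** Both loops come back to the hub through the trailing A, along the edge of A_n into the gate.
    This makes [step] invertible. *)
Lemma phi_pred n v v1 v2 : edge n.+1 v1 v -> edge n.+1 v2 v ->
  phi n v1 = phi n v2.
Proof.
case: (v =P hub) => [->|vh] e1 e2; last first.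
  by rewrite (edge_into_interior e1 vh) (edge_into_interior e2 vh).
have E v' : edge n.+1 v' hub -> phi n v' = pos n false (base_pos n).-1.
  case/edge_into_hub => c ->; rewrite phi_pos ?leq_pred // lenS.
  have b0 := base_pos_gt0 n.
  rewrite (_ : _ + _ = core_len n + (len n c + (base_pos n).-1)) ?walk_wrap //.
  by have := len_gt0 n c; lia.
by rewrite (E _ e1) (E _ e2).
Qed.

(* Where the [r]-th full traversal of loop [c'] of level [n] starts inside
   either loop of level [n.+1]. *)
Definition entry n (c' : bool) r :=
  (if c' then n.+3 else 1) * short_len n + r * len n c' - base_pos n.

Lemma entry_lt n c' r j c : r < n.+2 -> j <= len n c' ->
  entry n c' r + j < len n.+1 c.
Proof.
move=> rn jl; rewrite lenS /core_len /entry.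
have l1 := short_len_gt1 n; have := base_pos_gt0 n; have := base_pos_lt n.
have := len_gt0 n c.
have : r * len n c' + j <= n.+2 * len n c'.
  apply: (@leq_trans (r.+1 * len n c')); first by rewrite mulSn; lia.
  by rewrite leq_mul2r rn orbT.
by case: c' {jl}; rewrite ?len_false ?len_true; lia.
Qed.

(** The shift cuts the first A of the walk, so [n.+2] whole copies of A remain, as many as of B.
    They lie in the part common to both walks, whence a position independent of [c]. *)
Lemma phi_entry n c' r j c : r < n.+2 -> j <= len n c' ->
  phi n (pos n.+1 c (entry n c' r + j)) = pos n c' j.
Proof.
move=> rn jl; rewrite phi_pos; last exact/ltnW/entry_lt.
have rl : r * len n c' + j <= n.+2 * len n c'.
  apply: (@leq_trans (r.+1 * len n c')); first by rewrite mulSn; lia.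
  by rewrite leq_mul2r rn orbT.
have pl := base_pos_lt n.
rewrite /entry; case: c' jl rl => jl rl.
  rewrite (_ : base_pos n + _ = n.+3 * short_len n + (r * len n true + j)); last by lia.
  by rewrite walk_long ?posMD //; move: rl; rewrite /len addn1.
rewrite (_ : base_pos n + _ = (r.+1 * len n false + j));
  last by move: rl; rewrite /len; lia.
by rewrite walk_short ?posMD //; move: rl; rewrite /len; lia.
Qed.

(** * The system of threads *)

Lemma edge_valid n v v' : edge n v v' -> valid n v /\ valid n v'.
Proof. by case=> c [j [-> ->]]; split; exact: valid_pos. Qed.

(** At the hub these take loop A. By [phi_succ] and [phi_pred] that arbitrary choice disappears
    after one projection, which is why [step] and [back] compute coordinate [n] from coordinate
    [n.+1]. *)
Definition succ n (v : vertex) := pos n v.1 v.2.+1.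
Definition prec n (v : vertex) := pos n v.1 (v.2 + (len n v.1).-1).

Lemma edge_succ n v : valid n v -> edge n v (succ n v).
Proof. by move=> vv; rewrite -{1}(valid_eq vv); exact: edge_pos. Qed.

Lemma edge_prec n v : valid n v -> edge n (prec n v) v.
Proof.
move=> vv; rewrite -{2}(valid_eq vv).
have -> : pos n v.1 v.2 = pos n v.1 (v.2 + (len n v.1).-1).+1.
  by rewrite -addnS prednK ?len_gt0 // addnC -[len _ _]mul1n posMD.
exact: edge_pos.
Qed.

Record thread := Thread {
  level :> nat -> vertex;
  coord_valid : forall n, valid n (level n);
  coordE : forall n, level n = phi n (level n.+1) }.

Lemma thread_ext (x y : thread) : (forall n, x n = y n) -> x = y.
Proof.
case: x y => [x vx ex] [y vy ey] /= xy.
have E : x = y by apply: funext.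
by subst y; congr Thread; apply: Prop_irrelevance.
Qed.

Lemma coord_le (x y : thread) n m : n <= m -> x m = y m -> x n = y n.
Proof.
elim: m => [|m IH]; first by rewrite leqn0 => /eqP ->.
rewrite leq_eqVlt => /orP[/eqP -> //|nm] E; apply: IH => //.
by rewrite (coordE x m) (coordE y m) E.
Qed.

Lemma step_subproof (x : thread) n :
  edge n (x n) (phi n (succ n.+1 (x n.+1))).
Proof. by rewrite (coordE x n); apply/phi_edge/edge_succ/coord_valid. Qed.

Definition step (x : thread) : thread.
exists (fun n => phi n (succ n.+1 (x n.+1))) => n.
- by have [] := edge_valid (step_subproof x n).
- exact: phi_succ (edge_succ (coord_valid x _)) (step_subproof x n.+1).
Defined.

Lemma back_subproof (x : thread) n :
  edge n (phi n (prec n.+1 (x n.+1))) (x n).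
Proof. by rewrite (coordE x n); apply/phi_edge/edge_prec/coord_valid. Qed.

Definition back (x : thread) : thread.
exists (fun n => phi n (prec n.+1 (x n.+1))) => n.
- by have [] := edge_valid (back_subproof x n).
- exact: phi_pred (edge_prec (coord_valid x _)) (back_subproof x n.+1).
Defined.

Lemma edge_step (x : thread) n : edge n (x n) (step x n).
Proof. exact: step_subproof. Qed.

Lemma edge_back (x : thread) n : edge n (back x n) (x n).
Proof. exact: back_subproof. Qed.

(** At level [n.+1] both sides are successors of [back x], so they agree at level [n]. *)
Lemma backK x : step (back x) = x.
Proof.
apply: thread_ext => n; rewrite (coordE (step _) n) (coordE x n).
exact: phi_succ (edge_step _ _) (edge_back _ _).
Qed.

Lemma stepK x : back (step x) = x.
Proof.
apply: thread_ext => n; rewrite (coordE (back _) n) (coordE x n).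
exact: phi_pred (edge_back _ _) (edge_step _ _).
Qed.

Lemma step_coord (x y : thread) n : x n.+1 = y n.+1 -> step x n = step y n.
Proof. by rewrite /= => ->. Qed.

Lemma back_coord (x y : thread) n : x n.+1 = y n.+1 -> back x n = back y n.
Proof. by rewrite /= => ->. Qed.

Lemma exists_thread m v : valid m v -> exists x : thread, x m = v.
Proof.
(* A vertex is lifted into the first whole copy of its loop inside A of the next level. To treat all
   [n] alike, coordinate [n] comes from lifting [v] from level [m] to [m + n] and projecting down
   [m] levels. *)
pose lift n (v : vertex) := pos n.+1 false (entry n v.1 0 + v.2).
have liftK n w : valid n w -> phi n (lift n w) = w.
  by move=> vw; rewrite phi_entry ?valid_eq // ltnW // valid_lt.
pose up := fix up m k v := if k is k'.+1 then lift (m + k') (up m k' v) else v.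
pose down := fix down n k v :=
  if k is k'.+1 then down n k' (phi (n + k') v) else v.
have up_valid n k w : valid n w -> valid (n + k) (up n k w).
  elim: k => [|k IH] vw /=; first by rewrite addn0.
  by rewrite addnS; exact: valid_pos.
have down_valid n k w : valid (n + k) w -> valid n (down n k w).
  elim: k w => [|k IH] w /=; first by rewrite addn0.
  by rewrite addnS => vw; apply/IH/phi_valid.
(* The recursion of [down] peels off the top level; the thread condition needs the bottom one. *)
have downS n k w : down n k.+1 w = phi n (down n.+1 k w).
  elim: k w => [|k IH] w; first by rewrite /= addn0.
  by rewrite [RHS]/= addSnnS -IH.
have upK n k w : valid n w -> down n k (up n k w) = w.
  by move=> vw; elim: k => //= k IH; rewrite liftK //; exact: up_valid.
move=> vv.
have dv n : valid n (down n m (up m n v)).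
  by apply: down_valid; rewrite addnC; exact: up_valid.
have de n : down n m (up m n v) = phi n (down n.+1 m (up m n.+1 v)).
  by rewrite -downS /= addnC liftK //; exact: up_valid.
by exists (Thread dv de); rewrite /= upK.
Qed.

(** * Orbits and visits to the hubs *)

Lemma follow (x : thread) n c j k : 0 < j -> j + k <= len n c ->
  x n = pos n c j -> iter k step x n = pos n c (j + k).
Proof.
move=> j0; elim: k => [|k IH] jk xj; first by rewrite addn0.
have jk' : 0 < j + k < len n c by lia.
have := edge_step (iter k step x) n.
rewrite IH //; last by lia.
by move/edge_interior; rewrite pos_small // addnS; apply; case=> _; lia.
Qed.

Lemma follow_hub (x : thread) n : x n = hub ->
  exists c, forall k, k <= len n c -> iter k step x n = pos n c k.
Proof.
move=> xh; have := edge_step x n; rewrite xh => /edge_hub[c xc].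
exists c => -[_|k kl]; first by rewrite pos0.
by rewrite iterSr (follow (c := c) (j := 1)).
Qed.

Lemma reach_hub (x : thread) n : exists k, iter k step x n = hub.
Proof.
case: (x n =P hub) => [xh|xh]; first by exists 0.
have /andP[j0 jl] := validP (coord_valid x n) xh.
exists (len n (x n).1 - (x n).2).
rewrite (follow (c := (x n).1) (j := (x n).2)) // ?subnKC ?pos_len ?(ltnW jl) //.
by rewrite valid_eq //; exact: coord_valid.
Qed.

(** Entry positions are the same in both loops of level [n.+1], so one time serves all threads,
    whichever loop they enter. *)
Lemma from_hub n v : valid n v ->
  exists i, forall x : thread, x n.+1 = hub -> iter i step x n = v.
Proof.
move=> vv; exists (entry n v.1 0 + v.2) => x /follow_hub[c xc].
have vl := ltnW (valid_lt vv).
by rewrite coordE xc ?phi_entry ?valid_eq // ltnW // entry_lt.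
Qed.

Lemma from_hub_le n m v : n <= m -> valid n v ->
  exists i, forall x : thread, x m.+1 = hub -> iter i step x n = v.
Proof.
move=> nm /exists_thread[y <-]; have [i hi] := from_hub (coord_valid y m).
by exists i => x xh; apply: coord_le nm _; exact: hi.
Qed.

Lemma visit (x : thread) n v : valid n v -> exists k, iter k step x n = v.
Proof.
case/from_hub => i hi; have [k xk] := reach_hub x n.+1.
by exists (i + k); rewrite iterD; exact: hi.
Qed.

(** * Return times to the hubs *)

Definition hub_return n l :=
  exists x : thread, x n = hub /\ iter l step x n = hub.

(** Inside A of level [n.+1] the copies of loop [c] follow one another; the thread starts at copy 0,
    an interior position, and makes [d] turns. *)
Lemma hub_return_loops n c d : d < n.+2 -> hub_return n (d * len n c).
Proof.
move=> dn; pose t := entry n c 0.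
have pa := base_pos_lt n.
have t0 : 0 < t by rewrite /t /entry; case: (c); lia.
have tE k : t + k * len n c = entry n c k.
  by rewrite /t /entry; case: (c); lia.
have val k : k < n.+2 -> phi n (pos n.+1 false (t + k * len n c)) = hub.
  by move=> kn; rewrite tE -[entry _ _ _]addn0 phi_entry ?pos0.
have [x xt] := exists_thread (valid_pos n.+1 false t).
exists x; split.
  by rewrite coordE xt -[t]addn0 -(mul0n (len n c)) val.
rewrite coordE (follow (c := false) (j := t)) ?val //.
by rewrite tE -[entry _ _ _]addn0 ltnW // entry_lt.
Qed.

(** The higher hub lies over the gate of level [n], but by [from_hub_le] the delay from there to the
    hub of level [n] is the same at both ends of the return. *)
Lemma hub_return_le n m l : n < m -> hub_return m l -> hub_return n l.
Proof.
case: m => // m nm [x [xh xl]]; have [i hi] :=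
  from_hub_le (n := n) (m := m) nm (valid_hub n).
exists (iter i step x); split; first exact: hi.
by rewrite -iterD addnC iterD; exact: hi.
Qed.

Lemma short_len_gtn n : n < short_len n.
Proof. by elim: n => //= n IH; lia. Qed.

Lemma hub_return_diff n d b :
  exists l, [/\ b <= l, hub_return n l & hub_return n (l + d)].
Proof.
(* Level [k] exceeds [d], so [d] turns of A or of B occur in a row, and exceeds [b], so one turn
   lasts at least [b]. A turn of B is longer by 1, which gives the difference [d]; for [d = 0] one
   turn of A is used. *)
pose k := n + d + b + 1; have nk : n < k by rewrite /k; lia.
have kl := short_len_gtn k; case: d @k nk kl => [|d] k nk kl.
  have r : hub_return n (1 * len k false).
    by apply: (hub_return_le nk); exact: hub_return_loops.
  by exists (1 * len k false); rewrite addn0; split=> //;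
    rewrite len_false /k in kl *; lia.
have dk : d.+1 < k.+2 by rewrite /k; lia.
exists (d.+1 * len k false); split.
- by rewrite len_false mulSn; rewrite /k in kl *; lia.
- by apply: (hub_return_le nk); exact: hub_return_loops.
- rewrite (_ : _ + _ = d.+1 * len k true); last by rewrite len_false len_true; lia.
  by apply: (hub_return_le nk); exact: hub_return_loops.
Qed.

Lemma coord_mixing n s1 t1 s2 t2 :
  valid n s1 -> valid n t1 -> valid n s2 -> valid n t2 ->
  exists N, 0 < N /\ exists x y : thread,
    [/\ x n = s1, iter N step x n = t1, y n = s2 & iter N step y n = t2].
Proof.
move=> /from_hub[i1 h1] /from_hub[j1 k1] /from_hub[i2 h2] /from_hub[j2 k2].
(* If [s1] is met [i1] steps after a hub and [t1] is met [j1] steps after a return at time [l1], the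
   travel time is [j1 + l1 - i1]. Equating both travel times prescribes the difference of [l1] and
   [l2], as [hub_return_diff] allows; its lower bound makes [N] positive. *)
suff [N [l1 [l2 [N0 E1 E2 [x [x0 xl]] [y [y0 yl]]]]]] : exists N l1 l2,
    [/\ 0 < N, N + i1 = j1 + l1, N + i2 = j2 + l2, hub_return n.+1 l1
      & hub_return n.+1 l2].
  exists N; split => //; exists (iter i1 step x), (iter i2 step y).
  rewrite -!iterD E1 E2 !iterD.
  by split; [exact: h1 | exact: k1 | exact: h2 | exact: k2].
case: (leqP (i2 + j1) (i1 + j2)) => ij.
- have [l [bl r1 r2]] := hub_return_diff n.+1 (i1 + j2 - (i2 + j1)) i2.+1.
  by exists (l + j2 - i2), (l + (i1 + j2 - (i2 + j1))), l; split=> //; lia.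
- have [l [bl r1 r2]] := hub_return_diff n.+1 (i2 + j1 - (i1 + j2)) i1.+1.
  by exists (l + j1 - i1), l, (l + (i2 + j1 - (i1 + j2))); split=> //; lia.
Qed.

(** * Threads away from the hubs *)

Lemma hub_below (x : thread) n m : n < m -> x m = hub -> x n = gate n.
Proof.
move=> nm xh.
(* Admitting the gate closes the induction: one projection turns the hub into a gate, and gates go
   to gates. *)
suff : forall m', n < m' -> x m' = hub \/ x m' = gate m' -> x n = gate n.
  by apply; [exact: nm | left].
elim=> // {nm m xh}m IH; rewrite ltnS leq_eqVlt => /orP[/eqP <-|nm] xm.
  by rewrite coordE; case: xm => ->; rewrite (phi_hub, phi_gate).
apply: IH => //; right; rewrite coordE.
by case: xm => ->; rewrite (phi_hub, phi_gate).
Qed.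

Lemma hub_finite (x : thread) : exists n0, forall n, n0 <= n -> x n <> hub.
Proof.
case: (pselect (exists n, x n = hub)) => [[n xn]|nx]; last first.
  by exists 0 => n _ xn; apply: nx; exists n.
exists n.+1 => m nm xm; have := hub_below nm xm.
by rewrite xn => /esym/gate_neq_hub.
Qed.

(** Copies 0 and 1 of the loop of [x n] inside A of level [n.+1] give two vertices over [x n], one
    of which differs from [x n.+1]. Hence no thread is isolated. *)
Lemma coord_branch (x : thread) n :
  exists y : thread, y n = x n /\ y n.+1 <> x n.+1.
Proof.
have vx := coord_valid x n; have xl := ltnW (valid_lt vx).
pose t r := entry n (x n).1 r + (x n).2.
have t1 : t 1 = t 0 + len n (x n).1.
  by have := base_pos_lt n; rewrite /t /entry; case: (x n).1; lia.
have t0 : 0 < t 0 by have := base_pos_lt n; rewrite /t /entry; case: (x n).1; lia.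
have tl r : r < n.+2 -> t r < len n.+1 false by move=> rn; exact: entry_lt.
have l0 := len_gt0 n (x n).1.
have tne : pos n.+1 false (t 0) <> pos n.+1 false (t 1).
  have p0 : 0 < t 0 < len n.+1 false by rewrite t0 tl.
  have p1 : 0 < t 1 < len n.+1 false by rewrite tl // andbT; lia.
  by rewrite (pos_small p0) (pos_small p1); case; lia.
have ph r : r < n.+2 -> phi n (pos n.+1 false (t r)) = x n.
  by move=> rn; rewrite phi_entry ?valid_eq.
have [y0 Y0] := exists_thread (valid_pos n.+1 false (t 0)).
have [y1 Y1] := exists_thread (valid_pos n.+1 false (t 1)).
case: (x n.+1 =P pos n.+1 false (t 0)) => [E|E].
- by exists y1; rewrite coordE Y1 ph //; split=> // E'; apply: tne; rewrite -E -E'.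
- by exists y0; rewrite coordE Y0 ph //; split=> // /esym.
Qed.

Lemma step_interior (x : thread) n : x n <> hub -> step x n <> hub ->
  (step x n).2 = (x n).2.+1.
Proof.
move=> xh sh; have := edge_interior (edge_step x n) xh => E.
have /andP[j0 jl] := validP (coord_valid x n) xh.
rewrite E pos_small //=; move: (sh); rewrite E.
by have [//|jS] := ltnP; rewrite (_ : _.+1 = len n (x n).1) ?pos_len //; lia.
Qed.

Lemma step_same (x y : thread) n : x n <> hub -> x n = y n ->
  step x n = step y n.
Proof.
move=> xh E; rewrite (edge_interior (edge_step x n) xh).
by rewrite (edge_interior (edge_step y n)) -E.
Qed.

(** * The embedding in the real line *)

Local Open Scope ring_scope.

Definition vertex_code (v : vertex) : nat := (v.2.*2 + v.1)%N.
Definition codes n := (short_len n).+1.*2.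

Lemma code_inj : injective vertex_code.
Proof.
move=> [c j] [c' j'] E.
suff [-> ->] : c = c' /\ j = j' by [].
by move: E; rewrite /vertex_code /=; case: c; case: c' => /= E; split=> //; lia.
Qed.

Lemma code_lt n v : valid n v -> (vertex_code v < codes n)%N.
Proof. by move/valid_lt; rewrite /vertex_code /codes /len; case: v.1; lia. Qed.

(* The constants make [tail n], which is [2 * amplitude n * codes n.+1], bound
   the sum of all terms of the embedding from level [n] on, and make
   [2 * ratio n * (codes n.+1 + 1)] equal to [1 / (n + 1)]. *)
Definition ratio n : R := ((n.+1 * (codes n.+1).+1.*2)%N%:R)^-1.

Fixpoint amplitude n : R :=
  if n is m.+1 then
    amplitude m * ratio m ^+ (short_len m).+1 / (codes m.+2).*2.*2%:R
  else ((codes 1).*2.*2%:R)^-1.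

Definition scale n (v : vertex) : R := amplitude n * ratio n ^+ v.2.

Definition tail n : R := amplitude n * (codes n.+1).*2%:R.

Lemma ratio_gt0 n : 0 < ratio n.
Proof. by rewrite invr_gt0 ltr0n. Qed.

Lemma ratio_le1 n : ratio n <= 1.
Proof. by rewrite invf_le1 ?ltr0n // ler1n. Qed.

Lemma amplitude_gt0 n : 0 < amplitude n.
Proof.
elim: n => [|n IH] /=; first by rewrite invr_gt0 ltr0n.
by rewrite divr_gt0 ?ltr0n ?mulr_gt0 ?exprn_gt0 ?ratio_gt0.
Qed.

Lemma scale_gt0 n v : 0 < scale n v.
Proof. by rewrite mulr_gt0 ?exprn_gt0 ?ratio_gt0 ?amplitude_gt0. Qed.

Lemma scale_le n v : scale n v <= amplitude n.
Proof.
rewrite ler_piMr ?exprn_ile1 ?ratio_le1 ?(ltW (ratio_gt0 _)) //.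
exact: ltW (amplitude_gt0 _).
Qed.

Lemma tail_gt0 n : 0 < tail n.
Proof. by rewrite mulr_gt0 ?amplitude_gt0 // ltr0n. Qed.

Lemma tail0 : tail 0 = 2^-1.
Proof.
rewrite /tail [amplitude 0]/=.
have : (codes 1)%:R != 0 :> R by rewrite pnatr_eq0.
by rewrite -!muln2 !natrM => ?; field.
Qed.

Lemma tailS n :
  tail n.+1 = amplitude n * ratio n ^+ (short_len n).+1 / 2.
Proof.
rewrite /tail [amplitude n.+1]/=; move: (_ * _ ^+ _) => z.
have : (codes n.+2)%:R != 0 :> R by rewrite pnatr_eq0.
by rewrite -!muln2 !natrM => ?; field.
Qed.

(** Positions at level [n] are at most [short_len n], so the power in [amplitude n.+1] is below
    every scale of level [n]. Later terms then fill at most half of any gap opened after level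
    [n]. *)
Lemma tailS_le_scale n v : valid n v -> tail n.+1 <= scale n v / 2.
Proof.
move=> vv; rewrite tailS ler_wpM2r ?invr_ge0 // ler_wpM2l ?(ltW (amplitude_gt0 _)) //.
rewrite ler_wiXn2l ?ratio_le1 ?(ltW (ratio_gt0 _)) //.
by have := valid_lt vv; rewrite /len; case: v.1; lia.
Qed.

Lemma tailS_le n : tail n.+1 <= tail n / 2.
Proof.
apply: (le_trans (tailS_le_scale (valid_hub n))).
rewrite ler_wpM2r ?invr_ge0 // (le_trans (scale_le _ _)) //.
by rewrite ler_peMr ?(ltW (amplitude_gt0 _)) // ler1n.
Qed.

Lemma tail_anti n : tail n.+1 <= tail n.
Proof. by have := tailS_le n; have := tail_gt0 n; lra. Qed.

Lemma tail_small (eps : R) : 0 < eps -> exists n, tail n < eps.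
Proof.
move=> e0.
have tn n : tail n <= n.+1%:R^-1.
  elim: n => [|n IH]; first by rewrite tail0; lra.
  apply: (le_trans (tailS_le n)); rewrite ler_pdivrMr //.
  apply: (le_trans IH); rewrite ler_pdivlMl ?ltr0n // ler_pdivrMr ?ltr0n //.
  by rewrite -natrM ler_nat; lia.
have [n hn] := ltr_add_invr e0.
by exists n; apply: le_lt_trans (tn n) _; rewrite add0r in hn.
Qed.

(** The digit at level [m.+1] is weighted by the vertex below it, so threads agreeing up to level
    [m] also share the weight of the next digit. *)
Fixpoint emb_sum n (x : thread) : R :=
  if n is m.+1 then
    emb_sum m x + scale m (x m) * (vertex_code (x m.+1))%:R
  else (vertex_code (x 0))%:R.

Lemma emb_sum_succ n (x : thread) :
  emb_sum n.+1 x = emb_sum n x + scale n (x n) * (vertex_code (x n.+1))%:R.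
Proof. by []. Qed.

(** The upper bound is a difference of tails so that it telescopes. *)
Lemma emb_sumS n (x : thread) :
  emb_sum n x <= emb_sum n.+1 x <= emb_sum n x + tail n - tail n.+1.
Proof.
rewrite /= lerDl mulr_ge0 ?(ltW (scale_gt0 _ _)) //= -addrA lerD2l.
have : scale n (x n) * (vertex_code (x n.+1))%:R <= tail n / 2.
  rewrite /tail -muln2 natrM mulrA mulfK ?pnatr_eq0 //.
  rewrite ler_pM ?(ltW (scale_gt0 _ _)) ?scale_le //.
  by rewrite ler_nat ltnW // code_lt //; exact: coord_valid.
by have := tailS_le n; lra.
Qed.

Lemma emb_sum_le n m (x : thread) : (n <= m)%N ->
  emb_sum n x <= emb_sum m x <= emb_sum n x + tail n - tail m.
Proof.
elim: m => [|m IH]; first by rewrite leqn0 => /eqP ->; lra.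
rewrite leq_eqVlt => /orP[/eqP ->|nm]; first by lra.
by have := IH nm; have := emb_sumS m x; lra.
Qed.

Definition emb (x : thread) : R := sup (range (emb_sum ^~ x)).

Lemma emb_bounds n (x : thread) : emb_sum n x <= emb x <= emb_sum n x + tail n.
Proof.
have ub : ubound (range (emb_sum ^~ x)) (emb_sum n x + tail n).
  move=> _ [m _ <-]; have := tail_gt0 n; have := tail_gt0 m.
  have [/emb_sum_le|/ltnW /emb_sum_le] := leqP m n => /(_ x); lra.
have ne : range (emb_sum ^~ x) !=set0 by exists (emb_sum 0 x); exists 0%N.
apply/andP; split; last exact: ge_sup.
by apply: ub_le_sup; [exists (emb_sum n x + tail n) | exists n].
Qed.

Lemma emb_sum_eq n (x y : thread) : x n = y n -> emb_sum n x = emb_sum n y.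
Proof.
elim: n => [|n IH] E /=; first by rewrite E.
have E' := coord_le (leqnSn n) E.
by rewrite E E' IH.
Qed.

Lemma emb_close n (x y : thread) : x n = y n -> `|emb x - emb y| <= tail n.
Proof.
move/emb_sum_eq => E; have := emb_bounds n x; have := emb_bounds n y.
by rewrite E ler_norml; lra.
Qed.

(** The extra 1 absorbs the tails. With [emb_sep] this fixes the distance of threads parting after
    level [n] up to a factor that [ratio n] is chosen to beat. *)
Lemma emb_close_scale n (x y : thread) : x n = y n ->
  `|emb x - emb y| <= scale n (x n) * (codes n.+1).+1%:R.
Proof.
move=> E; have := emb_bounds n.+1 x; have := emb_bounds n.+1 y.
have := tailS_le_scale (coord_valid x n); have s0 := scale_gt0 n (x n).
rewrite !emb_sum_succ (emb_sum_eq E) -E.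
have -> : (codes n.+1).+1%:R = (codes n.+1)%:R + 1 :> R by rewrite natr1.
rewrite mulrDr mulr1.
have H (z : thread) :
    0 <= scale n (x n) * (vertex_code (z n.+1))%:R <= scale n (x n) * (codes n.+1)%:R.
  rewrite mulr_ge0 ?(ltW s0) //= ler_wpM2l ?(ltW s0) //.
  by rewrite ler_nat ltnW // code_lt //; exact: coord_valid.
by have := H x; have := H y; rewrite ler_norml; lra.
Qed.

Lemma nat_dist_ge1 (i j : nat) : i <> j -> 1 <= `|i%:R - j%:R| :> R.
Proof.
move=> ij; wlog lij : i j ij / (i < j)%N.
  move=> W; have [/W|/W|//] := ltngtP i j; first exact.
  by rewrite distrC => /(_ (nesym ij)).
rewrite distrC -natrB ?(ltnW lij) // ger0_norm // ler1n subn_gt0 //.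
Qed.

Lemma emb_sep n (x y : thread) : x n = y n -> x n.+1 <> y n.+1 ->
  scale n (x n) / 2 <= `|emb x - emb y|.
Proof.
move=> E NE; have := emb_bounds n.+1 x; have := emb_bounds n.+1 y.
have := tailS_le_scale (coord_valid x n); have s0 := scale_gt0 n (x n).
rewrite !emb_sum_succ (emb_sum_eq E) -E.
have c1 : scale n (x n) <=
    `|scale n (x n) * (vertex_code (x n.+1))%:R -
       scale n (x n) * (vertex_code (y n.+1))%:R|.
  rewrite -mulrBr normrM gtr0_norm // ler_peMr ?(ltW s0) //.
  by apply: nat_dist_ge1 => /code_inj.
by move: c1; rewrite ler_normr ler_normr => /orP[] ? *; apply/orP; [left|right]; lra.
Qed.

(** At the first level of disagreement [emb_sep] leaves a gap no smaller than the tail there; at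
    level 0, codes are at least 1 apart and [tail 0] is 1/2. With [emb_close], balls and cylinders
    define the same topology. *)
Lemma emb_agree n (x y : thread) : `|emb x - emb y| < tail n -> x n = y n.
Proof.
elim: n => [|n IH] lt.
  apply: contrapT => ne.
  have := emb_bounds 0 x; have := emb_bounds 0 y; rewrite /= tail0 in lt *.
  have : 1 <= `|(vertex_code (x 0))%:R - (vertex_code (y 0))%:R| :> R.
    by apply: nat_dist_ge1 => /code_inj.
  by move: lt; rewrite ltr_norml ler_normr => ? /orP[]; lra.
have E := IH (lt_le_trans lt (tail_anti n)).
apply: contrapT => /(emb_sep E); have := tailS_le_scale (coord_valid x n).
lra.
Qed.

Lemma emb_inj : injective emb.
Proof.
move=> x y E; apply: thread_ext => n; apply: emb_agree.
by rewrite E subrr normr0 tail_gt0.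
Qed.

Lemma emb_step_contract (x : thread) (eps : R) : 0 < eps ->
  exists n, forall y : thread, y n = x n ->
    `|emb (step y) - emb (step x)| <= eps * `|emb y - emb x|.
Proof.
move=> e0; have [n1 h1] := hub_finite x; have [n2 h2] := hub_finite (step x).
(* From level [n] on, neither [x] nor [step x] is at a hub, and the factor [1 / (m + 1)] found below
   is less than [eps]. *)
have [n3 h3] := ltr_add_invr e0; rewrite add0r in h3.
pose n := maxn (maxn n1 n2) n3; exists n => y E.
case: (pselect (y = x)) => [->|ne]; first by rewrite !subrr normr0 mulr0.
have /ex_minnP[m /asboolP mne mmin] : exists m, `[< y m <> x m >].
  apply: contrapT => H; apply: ne; apply: thread_ext => m.
  by apply: contrapT => /asboolP ?; apply: H; exists m.
have nm : (n < m)%N by rewrite ltnNge; apply/negP => /coord_le/(_ E).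
(* From here on [m] is the last level at which [x] and [y] agree. *)
case: m mne mmin nm => // m mne mmin nm.
have Em : y m = x m.
  by apply: contrapT => /asboolP /mmin; rewrite ltnn.
have xh : x m <> hub by apply: h1; lia.
have sh : step x m <> hub by apply: h2; lia.
have := emb_sep Em mne; have := emb_close_scale (esym (step_same xh (esym Em))).
have -> : scale m (step y m) = ratio m * scale m (y m).
  by rewrite -(step_same xh (esym Em)) Em /scale step_interior // exprS; ring.
move=> c1 c2; apply: (le_trans c1).
have mE : ratio m * (codes m.+1).+1%:R * 2 = m.+1%:R^-1.
  by rewrite /ratio -muln2 !natrM; field; rewrite !nat1r !pnatr_eq0.
have me : m.+1%:R^-1 <= eps.
  apply/ltW/(le_lt_trans _ h3); rewrite lef_pV2 ?posrE ?ltr0n // ler_nat; lia.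
have -> : ratio m * scale m (y m) * (codes m.+1).+1%:R =
    ratio m * (codes m.+1).+1%:R * 2 * (scale m (y m) / 2) by field.
rewrite mE ler_pM ?invr_ge0 ?divr_ge0 ?(ltW (scale_gt0 _ _)) //.
Qed.

(** * Topology *)

(** The metric is pulled back along [emb]; [nbhs_thread] recovers the inverse limit topology. *)
Definition thread_dist (x y : thread) : R := `|emb x - emb y|.

Lemma thread_dist_refl x : thread_dist x x = 0.
Proof. by rewrite /thread_dist subrr normr0. Qed.

Lemma thread_dist_eq0 x y : thread_dist x y = 0 -> x = y.
Proof. by move/normr0_eq0/eqP; rewrite subr_eq0 => /eqP/emb_inj. Qed.

Lemma thread_dist_sym x y : thread_dist x y = thread_dist y x.
Proof. exact: distrC. Qed.

Lemma thread_dist_triangle y x z :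
  thread_dist x z <= thread_dist x y + thread_dist y z.
Proof. exact: ler_distD. Qed.

HB.instance Definition _ := gen_eqMixin thread.
HB.instance Definition _ := gen_choiceMixin thread.
HB.instance Definition _ := isMetric.Build R thread
  thread_dist_refl thread_dist_eq0 thread_dist_sym thread_dist_triangle.

Lemma nbhs_thread (x : thread) (U : set thread) :
  nbhs x U <-> exists n, forall y : thread, y n = x n -> U y.
Proof.
split=> [/nbhs_ballP[e /= e0 eU]|[n nU]].
  have [n ne] := tail_small e0; exists n => y yx; apply: eU.
  by rewrite ballEmdist /=; apply: le_lt_trans ne; exact: emb_close.
apply/nbhs_ballP; exists (tail n); first exact: tail_gt0.
by move=> y; rewrite ballEmdist /= => /emb_agree E; exact/nU/esym.
Qed.

Lemma thread_continuous (F : thread -> thread) :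
  (forall n, exists m, forall x y : thread, x m = y m -> F x n = F y n) ->
  continuous F.
Proof.
move=> HF x U /nbhs_thread[n nU]; have [m hm] := HF n.
by apply/nbhs_thread; exists m => y yx; apply: nU; exact: hm.
Qed.

Lemma step_continuous : continuous step.
Proof. by apply: thread_continuous => n; exists n.+1 => x y; exact: step_coord. Qed.

Lemma back_continuous : continuous back.
Proof. by apply: thread_continuous => n; exists n.+1 => x y; exact: back_coord. Qed.

Lemma emb_continuous : continuous emb.
Proof.
move=> x U /nbhs_ballP[e /= e0 eU]; have [n ne] := tail_small e0.
apply/nbhs_thread; exists n => y yx; apply: eU.
by apply: le_lt_trans ne; exact: emb_close.
Qed.

Definition origin : thread := projT1 (cid (exists_thread (valid_hub 0))).

Definition unemb (r : R) : thread := xget origin [set x | emb x = r].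

Lemma embK : cancel emb unemb.
Proof.
move=> x; apply: emb_inj.
by apply: (xgetPex origin (P := [set y | emb y = emb x])); exists x.
Qed.

Lemma unemb_continuous : {within range emb, continuous unemb}.
Proof.
apply/subspace_continuousP => _ [x _ <-] U.
rewrite /from_subspace embK => /nbhs_thread[n nU].
rewrite /within /= nbhs_simpl /=.
apply/nbhs_ballP; exists (tail n); first exact: tail_gt0.
move=> r + [y _ yr]; rewrite -{r}yr => /emb_agree E.
by suff : U (unemb (emb y)) by []; rewrite embK; exact/nU/esym.
Qed.

(** * Cantor set properties *)

Lemma coord_clopen n v : clopen [set x : thread | x n = v].
Proof.
split; first by rewrite openE => x <-; apply/nbhs_thread; exists n.
move=> x cx; have /cx[y [/= -> ->]] // : nbhs x [set y : thread | y n = x n].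
by apply/nbhs_thread; exists n.
Qed.

Lemma thread_totally_disconnected : totally_disconnected [set: thread].
Proof.
apply: zero_dimension_totally_disconnected => x y /eqP xy.
have [n xyn] : exists n, x n <> y n.
  apply: contrapT => H; apply/xy/thread_ext => n.
  by apply: contrapT => ?; apply: H; exists n.
by exists [set z : thread | z n = x n]; split=> [|//|/esym //]; exact: coord_clopen.
Qed.

(** [unemb] carries a connected subset of the range to a connected set of threads, hence to a
    point. *)
Lemma range_emb_totally_disconnected : totally_disconnected (range emb).
Proof.
move=> r Kr; rewrite eqEsubset; split=> [z [C [Cr CK Cc] Cz]|_ ->];
  last exact: connected_component_refl.
have cC : connected (unemb @` C).
  apply: connected_continuous_connected Cc _.
  exact: continuous_subspaceW CK unemb_continuous.
have /= : connected_component setT (unemb r) (unemb z).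
  by exists (unemb @` C); [split => //; exists r | exists z].
rewrite thread_totally_disconnected //= => E.
have [x _ xr] := Kr; have [y _ yz] := CK _ Cz.
by rewrite -xr -yz; move: E; rewrite -xr -yz !embK => ->.
Qed.

Lemma range_emb_closed : closed (range emb).
Proof.
move=> r cr.
have ap n : exists x, `|emb x - r| < tail n / 2.
  have /cr[_ [[x _ <-]]] : nbhs r (ball r (tail n / 2)).
    by apply: nbhsx_ballx; rewrite divr_gt0 ?tail_gt0.
  by rewrite /ball /= distrC; exists x.
pose X n := projT1 (cid (ap n)).
have XP n : `|emb (X n) - r| < tail n / 2 by exact: (projT2 (cid (ap n))).
(* Consecutive approximants are within [tail n], so they agree at level [n] and the diagonal is a
   thread. *)
have XS n : X n n = X n.+1 n.
  apply: emb_agree; have := XP n; have := XP n.+1; have := tail_anti n.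
  by rewrite !ltr_norml; lra.
pose y := Thread (fun n => coord_valid (X n) n)
  (fun n => etrans (XS n) (coordE (X n.+1) n)).
exists y => //; apply/eqP; rewrite -subr_eq0 -normr_le0; apply/ler_addgt0Pl => e e0.
have [n ne] := @tail_small (e / 2) (divr_gt0 e0 (ltr0n _ 2)).
have : `|emb y - emb (X n)| <= tail n by apply: emb_close.
have := XP n; have := tail_gt0 n; rewrite addr0 ltr_norml !ler_norml; lra.
Qed.

Lemma range_emb_compact : compact (range emb).
Proof.
apply: (subclosed_compact range_emb_closed
  (segment_compact (a := 0) (b := (codes 0)%:R + 1))).
move=> _ [x _ <-] /=; rewrite in_itv /=; have := emb_bounds 0 x.
rewrite tail0 /=; have : (vertex_code (x 0%N))%:R <= (codes 0)%:R :> R.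
  by rewrite ler_nat ltnW // code_lt //; exact: coord_valid.
have : 0 <= (vertex_code (x 0%N))%:R :> R by [].
lra.
Qed.

(** Compactness is obtained on the line, from closed and bounded, and carried back by [unemb]. *)
Lemma thread_compact : compact [set: thread].
Proof.
have -> : [set: thread] = unemb @` range emb.
  by apply/seteqP; split=> // x _; exists (emb x); [exists x | exact: embK].
exact: continuous_compact unemb_continuous range_emb_compact.
Qed.

Lemma thread_cantor : cantor_set [set: thread].
Proof.
split; [by exists origin | exact: thread_compact | exact: thread_totally_disconnected |].
move=> x _ [_ [V /nbhs_thread[n nV]]]; rewrite setIT => E.
have [y [yx ny]] := coord_branch x n.
by have := nV y yx; rewrite E /= => yE; apply: ny; rewrite yE.
Qed.

Lemma range_emb_cantor : cantor_set (range emb).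
Proof.
split; [by exists (emb origin); exists origin | exact: range_emb_compact
  | exact: range_emb_totally_disconnected |].
move=> _ [x _ <-] [_ [V /emb_continuous /nbhs_thread[n nV] E]].
have [y [yx ny]] := coord_branch x n.
have : (V `&` range emb) (emb y) by split; [exact: nV | exists y].
by rewrite E /= => /emb_inj yE; apply: ny; rewrite yE.
Qed.

(** * Minimality, weak mixing and the derivative *)

Lemma step_minimal : minimal_sys step.
Proof.
move=> A [x Ax] cA sA; apply/seteqP; split=> // z _; apply: cA => U /nbhs_thread[n nU].
have [k xk] := visit x (coord_valid z n); exists (iter k step x); split; last exact: nU.
by elim: k {xk} => //= k IH; rewrite -sA; exists (iter k step x).
Qed.

Lemma iter_pair (T : Type) (F : T -> T) n (p : T * T) :
  iter n (fun p => (F p.1, F p.2)) p = (iter n F p.1, iter n F p.2).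
Proof. by elim: n => [|n /= ->] //; case: p. Qed.

Lemma open_pair_coord (U : set (thread * thread)) : open U -> U !=set0 ->
  exists p : thread * thread, exists n, forall x y : thread,
    x n = p.1 n -> y n = p.2 n -> U (x, y).
Proof.
move=> oU [p Up]; exists p.
have [[P1 P2] /= [/nbhs_thread[n1 h1] /nbhs_thread[n2 h2]] PU] : nbhs p U.
  exact: open_nbhs_nbhs.
exists (maxn n1 n2) => x y xp yp; apply: PU; split=> /=; [apply: h1 | apply: h2].
  by apply: coord_le xp; rewrite leq_maxl.
by apply: coord_le yp; rewrite leq_maxr.
Qed.

Lemma step_weakly_mixing : weakly_mixing step.
Proof.
move=> U V oU oV /(open_pair_coord oU)[s [n1 hU]] /(open_pair_coord oV)[t [n2 hV]].
pose n := maxn n1 n2.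
have [N [N0 [x [y [xs xt ys yt]]]]] := coord_mixing (coord_valid s.1 n)
  (coord_valid t.1 n) (coord_valid s.2 n) (coord_valid t.2 n).
exists N; split => //; exists (iter N step x, iter N step y); split.
  exists (x, y); last by rewrite iter_pair.
  by apply: hU; [apply: coord_le xs | apply: coord_le ys]; rewrite leq_maxl.
by apply: hV; [apply: coord_le xt | apply: coord_le yt]; rewrite leq_maxr.
Qed.

Lemma conj_continuous (F : thread -> thread) : continuous F ->
  {within range emb, continuous (emb \o F \o unemb)}.
Proof.
move=> cF; apply/subspace_continuousP => r Kr.
have uc := (subspace_continuousP _ _).1 unemb_continuous r Kr.
have ec : emb \o F @ unemb r --> emb (F (unemb r)).
  exact: cvg_comp (cF _) (@emb_continuous _).
exact: cvg_comp uc ec.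
Qed.

Lemma zero_deriv_step : zero_deriv_on (range emb) (emb \o step \o unemb).
Proof.
move=> _ [x _ <-]; move=> U /nbhs_ballP[e /= e0 eU].
(* The contraction bound is not strict while the ball is, hence [e / 2]. *)
have [n hn] := emb_step_contract x (divr_gt0 e0 (ltr0n _ 2)).
apply/nbhs_ballP; exists (tail n) => /=; first exact: tail_gt0.
move=> r + yx [y _ yr]; rewrite -{r}yr in yx * => /emb_agree E.
apply: eU; rewrite /ball /= !embK sub0r normrN normrM normfV.
apply: (@le_lt_trans _ _ (e / 2)); last by lra.
by rewrite ler_pdivrMr ?normr_gt0 ?subr_eq0 //; exact/hn/esym.
Qed.

Theorem theoremB :
  exists (X : metricType Rdefinitions.R) (T : X -> X) (K : set Rdefinitions.R) (f : Rdefinitions.R -> Rdefinitions.R) (h : X -> Rdefinitions.R),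
    [/\ cantor_set [set: X], homeo_onto [set: X] [set: X] T,
        minimal_sys T & weakly_mixing T] /\
    [/\ cantor_set K, homeo_onto K K f & zero_deriv_on K f] /\
    (homeo_onto [set: X] K h /\ forall x : X, h (T x) = f (h x)).
Proof.
exists thread, step, (range emb), (emb \o step \o unemb), emb; split; [|split; [|split]].
- split; [exact: thread_cantor | | exact: step_minimal | exact: step_weakly_mixing].
  split=> //; first exact/continuous_subspaceT/step_continuous.
  exists back; split=> // [|x _|x _]; [|exact: stepK|exact: backK].
  exact/continuous_subspaceT/back_continuous.
- split; [exact: range_emb_cantor | | exact: zero_deriv_step].
  split; [by move=> _ [_ [x _ <-] <-]; eexists|exact/conj_continuous/step_continuous|].
  exists (emb \o back \o unemb); split.
  + by move=> _ [_ [x _ <-] <-]; eexists.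
  + exact/conj_continuous/back_continuous.
  + by move=> _ [x _ <-]; rewrite /= !embK stepK.
  + by move=> _ [x _ <-]; rewrite /= !embK backK.
- split=> //; first exact/continuous_subspaceT/emb_continuous.
  exists unemb; split=> //; [exact: unemb_continuous | by move=> x _; rewrite embK |].
  by move=> _ [x _ <-]; rewrite embK.
- by move=> x; rewrite /= embK.
Qed.
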